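(* Let $D$ be a one-dimensional integral domain. If $\mathrm{Max}(D)$, endowed with the inverse topology, is scattered and $\mathrm{Inv}(D_M)$ is free for every $M\in\mathrm{Max}(D)$, then $$\mathrm{Inv}(D)\simeq\bigoplus_{M\in\mathrm{Max}(D)}\mathrm{Inv}(D_M).$$ In particular, $\mathrm{Inv}(D)$ is free.
   Context: $\mathrm{Inv}(A)$ denotes the group of invertible fractional ideals of an integral domain $A$ under multiplication. ''Free'' means free abelian. $\mathrm{Max}(D)$ is the set of maximal ideals of $D$. The inverse topology on $\mathrm{Spec}(D)$ (and, by restriction, on its subsets) is the topology having as a subbasis of open sets the sets $V(I)=\{P\in\mathrm{Spec}(D)\mid I\subseteq P\}$, as $I$ ranges among the finitely generated ideals of $D$. For a topological space $X$, let $\mathcal{D}(X)$ be the set of non-isolated points of $X$; set $\mathcal{D}^0(X)=X$, $\mathcal{D}^{\beta+1}(X)=\mathcal{D}(\mathcal{D}^\beta(X))$, and $\mathcal{D}^\alpha(X)=\bigcap_{\beta<\alpha}\mathcal{D}^\beta(X)$ for limit $\alpha$. $X$ is scattered if $\mathcal{D}^\alpha(X)=\emptyset$ for some ordinal $\alpha$. *)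

(* Defs.v *)
From HB Require Import structures.
From mathcomp Require Import all_boot all_order all_algebra.
From mathcomp Require Import all_classical topology.
From mathcomp Require wochoice.

Set Implicit Arguments.
Unset Strict Implicit.
Unset Printing Implicit Defensive.

Import GRing.Theory.

Local Open Scope ring_scope.
Local Open Scope classical_set_scope.

Definition isomorphic (G H : zmodType) : Prop :=
  exists f : {additive G -> H}, bijective f.

Record dirsum (I : Type) (G : I -> zmodType) := Dirsum {
  dirsum_fun :> forall i, G i;
  dirsum_finite : finite_set [set i | dirsum_fun i != 0] }.

Lemma dirsum_ext (I : Type) (G : I -> zmodType) (f g : dirsum G) :
  (forall i, f i = g i) -> f = g.
Proof.
case: f g => [f fP] [g gP] /= fg.
have {}fg : f = g by exact: functional_extensionality_dep.
by rewrite fg in fP *; congr Dirsum; exact: Prop_irrelevance.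
Qed.

Section DirsumZmodule.
Variables (I : Type) (G : I -> zmodType).

Lemma dirsum_zero_subproof : finite_set [set i | (0 : G i) != 0].
Proof. by apply: (sub_finite_set _ (finite_set0 I)) => i /=; rewrite eqxx. Qed.

Lemma dirsum_opp_subproof (f : dirsum G) : finite_set [set i | - f i != 0].
Proof.
by apply: (sub_finite_set _ (dirsum_finite f)) => i /=; rewrite oppr_eq0.
Qed.

Lemma dirsum_add_subproof (f g : dirsum G) :
  finite_set [set i | f i + g i != 0].
Proof.
have /sub_finite_set : [set i | f i + g i != 0] `<=`
  [set i | f i != 0] `|` [set i | g i != 0].
  move=> i /=; have [->|] := eqVneq (f i) 0; last by left.
  by rewrite add0r; right.
by apply; rewrite finite_setU; split; exact: dirsum_finite.
Qed.

Definition dirsum_zero : dirsum G := Dirsum dirsum_zero_subproof.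
Definition dirsum_opp f : dirsum G := Dirsum (dirsum_opp_subproof f).
Definition dirsum_add f g : dirsum G := Dirsum (dirsum_add_subproof f g).

Lemma dirsum_addA : associative dirsum_add.
Proof. by move=> f g h; apply: dirsum_ext => i /=; rewrite addrA. Qed.

Lemma dirsum_addC : commutative dirsum_add.
Proof. by move=> f g; apply: dirsum_ext => i /=; rewrite addrC. Qed.

Lemma dirsum_add0 : left_id dirsum_zero dirsum_add.
Proof. by move=> f; apply: dirsum_ext => i /=; rewrite add0r. Qed.

Lemma dirsum_addN : left_inverse dirsum_zero dirsum_opp dirsum_add.
Proof. by move=> f; apply: dirsum_ext => i /=; rewrite addNr. Qed.

HB.instance Definition _ := gen_eqMixin (dirsum G).
HB.instance Definition _ := gen_choiceMixin (dirsum G).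
HB.instance Definition _ := GRing.isZmodule.Build (dirsum G)
  dirsum_addA dirsum_addC dirsum_add0 dirsum_addN.

End DirsumZmodule.

Definition free_abelian (G : zmodType) : Prop :=
  exists B : Type, isomorphic G (dirsum (fun _ : B => (int : zmodType))).

(* An integral domain given together with its quotient field [K], of which it
   is a subring. In this way a domain and its localizations all live in the
   same field. *)
Record subdomain (K : fieldType) := Subdomain {
  subdomain_set :> set K;
  subdomain_subring : subring_closed [in subdomain_set];
  subdomain_frac : forall x, exists a b,
    [/\ subdomain_set a, subdomain_set b, b != 0 & x = a / b] }.

Section FractionalIdeals.
Variables (K : fieldType) (A : subdomain K).
Implicit Types I J L : set K.

Record fractional_ideal I : Prop := FractionalIdeal {
  fideal0 : I 0;
  fidealD : forall x y, I x -> I y -> I (x + y);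
  fidealM : forall a x, subdomain_set A a -> I x -> I (a * x);
  fideal_denom : exists d,
    [/\ subdomain_set A d, d != 0 & forall x, I x -> subdomain_set A (d * x)] }.

Definition ideal_mul I J : set K :=
  [set z | exists2 s : seq (K * K),
    (forall p, p \in s -> I p.1 /\ J p.2) & z = \sum_(p <- s) p.1 * p.2].

Definition invertible I : Prop := fractional_ideal I /\
  exists2 J, fractional_ideal J & ideal_mul I J = A.

Lemma subdomain1 : subdomain_set A 1.
Proof. by case: (subdomain_subring A) => /set_mem. Qed.

Lemma subdomainB x y :
  subdomain_set A x -> subdomain_set A y -> subdomain_set A (x - y).
Proof.
by case: (subdomain_subring A) => _ AB _ Ax Ay;
  apply/set_mem/AB; exact: mem_set.
Qed.

Lemma subdomainM x y :
  subdomain_set A x -> subdomain_set A y -> subdomain_set A (x * y).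
Proof.
by case: (subdomain_subring A) => _ _ AM Ax Ay;
  apply/set_mem/AM; exact: mem_set.
Qed.

Lemma subdomain0 : subdomain_set A 0.
Proof. by rewrite -(subrr 1); apply: subdomainB; exact: subdomain1. Qed.

Lemma subdomainD x y :
  subdomain_set A x -> subdomain_set A y -> subdomain_set A (x + y).
Proof.
move=> Ax Ay; rewrite -[y]opprK -[- y]sub0r; apply: subdomainB => //.
by apply: subdomainB => //; exact: subdomain0.
Qed.

Lemma ideal_mul_gen I J x y : I x -> J y -> ideal_mul I J (x * y).
Proof.
move=> Ix Jy; exists [:: (x, y)]; last by rewrite big_seq1.
by move=> p; rewrite inE => /eqP ->.
Qed.

Lemma ideal_mul0 I J : ideal_mul I J 0.
Proof. by exists [::]; rewrite ?big_nil. Qed.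

Lemma ideal_mulD I J x y :
  ideal_mul I J x -> ideal_mul I J y -> ideal_mul I J (x + y).
Proof.
move=> [s sP ->] [t tP ->]; exists (s ++ t); last by rewrite big_cat.
by move=> p; rewrite mem_cat => /orP[/sP|/tP].
Qed.

Lemma ideal_mul_ind I J (P : K -> Prop) :
  P 0 -> (forall x y, P x -> P y -> P (x + y)) ->
  (forall x y, I x -> J y -> P (x * y)) -> forall z, ideal_mul I J z -> P z.
Proof.
move=> P0 PD PM _ [s sP ->]; rewrite big_seq; apply: big_ind => // p /sP[].
exact: PM.
Qed.

Lemma ideal_mulC : commutative ideal_mul.
Proof.
have sub I J : ideal_mul I J `<=` ideal_mul J I.
  apply: ideal_mul_ind; [exact: ideal_mul0|exact: ideal_mulD|].
  by move=> x y Ix Jy; rewrite mulrC; exact: ideal_mul_gen.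
by move=> I J; apply/seteqP.
Qed.

Lemma ideal_mulA : associative ideal_mul.
Proof.
have sub I J L : ideal_mul (ideal_mul I J) L `<=` ideal_mul I (ideal_mul J L).
  apply: ideal_mul_ind; [exact: ideal_mul0|exact: ideal_mulD|move=> u l IJu Ll].
  elim/ideal_mul_ind: IJu => [|x y|x y Ix Jy].
  - by rewrite mul0r; exact: ideal_mul0.
  - by rewrite mulrDl; exact: ideal_mulD.
  - by rewrite -mulrA; apply: ideal_mul_gen => //; exact: ideal_mul_gen.
move=> I J L; apply/seteqP; split; last exact: sub.
rewrite (ideal_mulC I) (ideal_mulC J) => z /sub.
by rewrite (ideal_mulC L) (ideal_mulC J I).
Qed.

Lemma ideal_mul1 I : fractional_ideal I -> ideal_mul A I = I.
Proof.
move=> Ifr; apply/seteqP; split=> [|x Ix]; last first.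
  by rewrite -[x]mul1r; apply: ideal_mul_gen => //; exact: subdomain1.
by apply: ideal_mul_ind; [exact: fideal0|exact: fidealD|exact: fidealM].
Qed.

Lemma fractional_subdomain : fractional_ideal A.
Proof.
split; [exact: subdomain0|exact: subdomainD|exact: subdomainM|].
exists 1; split; [exact: subdomain1|exact: oner_neq0|].
by move=> x; rewrite mul1r.
Qed.

Lemma fractional_mul I J :
  fractional_ideal I -> fractional_ideal J -> fractional_ideal (ideal_mul I J).
Proof.
move=> Ifr Jfr; split; [exact: ideal_mul0|exact: ideal_mulD| |].
  move=> a z Aa; elim/ideal_mul_ind => [|x y|x y Ix Jy].
  - by rewrite mulr0; exact: ideal_mul0.
  - by rewrite mulrDr; exact: ideal_mulD.
  - by rewrite mulrA; apply: ideal_mul_gen => //; exact: fidealM.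
have [d [Ad d0 dI]] := fideal_denom Ifr.
have [e [Ae e0 eJ]] := fideal_denom Jfr.
exists (d * e); split; [exact: subdomainM|by rewrite mulf_neq0|].
move=> z; elim/ideal_mul_ind => [|x y|x y Ix Jy].
- by rewrite mulr0; exact: subdomain0.
- by rewrite mulrDr; exact: subdomainD.
- by rewrite mulrACA; apply: subdomainM; [exact: dI|exact: eJ].
Qed.

Lemma invertible_one : invertible A.
Proof.
split; first exact: fractional_subdomain.
exists A; first exact: fractional_subdomain.
exact/ideal_mul1/fractional_subdomain.
Qed.

Lemma invertible_mul I J :
  invertible I -> invertible J -> invertible (ideal_mul I J).
Proof.
move=> [Ifr [I' I'fr II']] [Jfr [J' J'fr JJ']].
split; first exact: fractional_mul.
exists (ideal_mul J' I'); first exact: fractional_mul.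
by rewrite -ideal_mulA (ideal_mulA J) JJ' ideal_mul1.
Qed.

Lemma invertible_inv I :
  invertible I -> {J | invertible J & ideal_mul I J = A}.
Proof.
move=> [Ifr /cid2[J Jfr IJ]]; exists J => //; split=> //; exists I => //.
by rewrite ideal_mulC.
Qed.

End FractionalIdeals.

Record InvGroup (K : fieldType) (A : subdomain K) := MkInv {
  Inv_set :> set K;
  InvP : invertible A Inv_set }.

Lemma Inv_ext (K : fieldType) (A : subdomain K) (I J : InvGroup A) :
  I = J :> set K -> I = J.
Proof.
case: I J => [I IP] [J JP] /= IJ; rewrite IJ in IP *.
by congr MkInv; exact: Prop_irrelevance.
Qed.

(* [InvGroup A] is a [zmodType], so its group law, which is the multiplication
   of fractional ideals, is written additively; its zero is the ideal [A]. *)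
Section InvZmodule.
Variables (K : fieldType) (A : subdomain K).
Implicit Types I J : InvGroup A.

Definition Inv_one : InvGroup A := MkInv (invertible_one A).
Definition Inv_mul I J : InvGroup A := MkInv (invertible_mul (InvP I) (InvP J)).
Definition Inv_inv I : InvGroup A :=
  MkInv (s2valP (invertible_inv (InvP I))).

Lemma Inv_mulA : associative Inv_mul.
Proof. by move=> I J L; apply: Inv_ext; exact: ideal_mulA. Qed.

Lemma Inv_mulC : commutative Inv_mul.
Proof. by move=> I J; apply: Inv_ext; exact: ideal_mulC. Qed.

Lemma Inv_mul1 : left_id Inv_one Inv_mul.
Proof. by move=> I; apply: Inv_ext; apply: ideal_mul1; case: (InvP I). Qed.

Lemma Inv_mulV : left_inverse Inv_one Inv_inv Inv_mul.
Proof.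
move=> I; rewrite Inv_mulC; apply: Inv_ext => /=.
exact: (s2valP' (invertible_inv (InvP I))).
Qed.

HB.instance Definition _ := gen_eqMixin (InvGroup A).
HB.instance Definition _ := gen_choiceMixin (InvGroup A).
HB.instance Definition _ := GRing.isZmodule.Build (InvGroup A)
  Inv_mulA Inv_mulC Inv_mul1 Inv_mulV.

End InvZmodule.

(* [idealr_closed] includes that the ideal is proper. *)
Record Spec (D : idomainType) := MkSpec {
  Spec_set :> set D;
  Spec_ideal : idealr_closed [in Spec_set];
  Spec_prime : prime_idealr_closed [in Spec_set] }.

Definition MaxSpec (D : idomainType) : set (Spec D) :=
  [set M | forall J : set D, idealr_closed [in J] -> M `<=` J -> J = M].

Definition prime_chain (D : idomainType) (n : nat) (P : 'I_n.+1 -> Spec D) :=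
  forall i j : 'I_n.+1, (i < j)%N -> P i `<` P j.

Definition krull_dim_eq (D : idomainType) (n : nat) : Prop :=
  (exists P : 'I_n.+1 -> Spec D, prime_chain P) /\
  (forall m (P : 'I_m.+1 -> Spec D), prime_chain P -> (m <= n)%N).

Definition ideal_span (D : idomainType) (s : seq D) : set D :=
  [set x | exists c : nat -> D, x = \sum_(i < size s) c i * s`_i].

Definition fg_ideal (D : idomainType) : set (set D) := range (@ideal_span D).

(* [Spec D] carries the inverse topology, not the Zariski topology. *)
HB.instance Definition _ (D : idomainType) := gen_eqMixin (Spec D).
HB.instance Definition _ (D : idomainType) := gen_choiceMixin (Spec D).
HB.instance Definition _ (D : idomainType) := isSubBaseTopological.Build
  (Spec D) (@fg_ideal D) (fun I : set D => [set P : Spec D | I `<=` P]).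

Section Scattered.
Variable X : topologicalType.

Definition derived (Y : set X) : set X := Y `\` isolated Y.

(* An ordinal is represented by an element [t] of a type [T] well-ordered by
   [R], namely as the order type of its initial segment; [S] is then the
   transfinite sequence of the iterated derived sets of the subspace [Y]. *)
Section DerivedSequence.
Variables (T : Type) (R : rel T).

Definition ord_lt (s t : T) : Prop := R s t /\ s <> t.
Definition ord_zero (t : T) : Prop := forall s, ~ ord_lt s t.
Definition ord_succ (s t : T) : Prop :=
  ord_lt s t /\ forall r, ~ (ord_lt s r /\ ord_lt r t).
Definition ord_limit (t : T) : Prop :=
  ~ ord_zero t /\ forall s, ~ ord_succ s t.

Definition derived_sequence (Y : set X) (S : T -> set X) : Prop :=
  [/\ forall t, ord_zero t -> S t = Y,
      forall s t, ord_succ s t -> S t = derived (S s) &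
      forall t, ord_limit t -> S t = \bigcap_(s in ord_lt^~ t) S s].

End DerivedSequence.

Definition scattered (Y : set X) : Prop :=
  exists (T : Type) (R : rel T) (S : T -> set X),
    [/\ wochoice.well_order R, derived_sequence R Y S & exists t, S t = set0].

End Scattered.

Section Localization.
Variable D : idomainType.

Local Notation "x %:F" := (@FracField.tofrac D x).

Lemma fraction_surj (x : {fraction D}) :
  exists a b : D, b != 0 /\ x = a%:F / b%:F.
Proof.
elim/quotW: x => x; exists x.1, x.2; split; first exact: denom_ratioP.
have d0 := denom_ratioP x.
apply: (canRL (mulfK _)); first by rewrite tofrac_eq0.
unlock FracField.tofrac; rewrite -[LHS]FracField.pi_mul.
apply/eqmodP; rewrite /= FracField.equivfE /FracField.mulf.
by rewrite !numden_Ratio ?mulf_neq0 ?oner_neq0 // !mulr1 mulrC.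
Qed.

Definition domain_set : set {fraction D} := range (@FracField.tofrac D).

Lemma domain_subring : subring_closed [in domain_set].
Proof.
split; first by apply/mem_set; exists 1 => //; exact: tofrac1.
  move=> _ _ /set_mem[a _ <-] /set_mem[b _ <-].
  by apply/mem_set; exists (a - b) => //; exact: tofracB.
move=> _ _ /set_mem[a _ <-] /set_mem[b _ <-].
by apply/mem_set; exists (a * b) => //; exact: tofracM.
Qed.

Lemma domain_frac x : exists a b,
  [/\ domain_set a, domain_set b, b != 0 & x = a / b].
Proof.
have [a [b [b0 ->]]] := fraction_surj x; exists a%:F, b%:F.
by split; [exists a|exists b|rewrite tofrac_eq0|].
Qed.

Definition domain : subdomain {fraction D} :=
  Subdomain domain_subring domain_frac.

Variable P : Spec D.

Definition localization_set : set {fraction D} :=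
  [set x | exists a s : D, ~ Spec_set P s /\ x = a%:F / s%:F].

Lemma Spec_compl1 : ~ Spec_set P 1.
Proof. by case: (Spec_ideal P) => _ P1 _ /mem_set; apply/negP. Qed.

Lemma Spec_compl_neq0 s : ~ Spec_set P s -> s%:F != 0.
Proof.
move=> Ps; rewrite tofrac_eq0; apply/eqP => s0; apply: Ps; rewrite s0.
by case: (Spec_ideal P) => /set_mem.
Qed.

Lemma Spec_complM s t :
  ~ Spec_set P s -> ~ Spec_set P t -> ~ Spec_set P (s * t).
Proof. by move=> Ps Pt /mem_set/Spec_prime/orP[] /set_mem. Qed.

Lemma localization_subring : subring_closed [in localization_set].
Proof.
split.
- apply/mem_set; exists 1, 1; split; first exact: Spec_compl1.
  by rewrite tofrac1 divr1.
- move=> _ _ /set_mem[a [s [Ps ->]]] /set_mem[b [t [Pt ->]]].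
  apply/mem_set; exists (a * t - b * s), (s * t); split.
    exact: Spec_complM.
  have s0 := Spec_compl_neq0 Ps; have t0 := Spec_compl_neq0 Pt.
  by rewrite -mulNr addf_div // tofracB !tofracM mulNr.
- move=> _ _ /set_mem[a [s [Ps ->]]] /set_mem[b [t [Pt ->]]].
  apply/mem_set; exists (a * b), (s * t); split; first exact: Spec_complM.
  by rewrite !tofracM mulf_div.
Qed.

Lemma localization_frac x : exists a b,
  [/\ localization_set a, localization_set b, b != 0 & x = a / b].
Proof.
have sub a : localization_set a%:F.
  by exists a, 1; split; [exact: Spec_compl1|rewrite tofrac1 divr1].
have [a [b [b0 ->]]] := fraction_surj x; exists a%:F, b%:F.
by split; [exact: sub|exact: sub|rewrite tofrac_eq0|].
Qed.

Definition localization : subdomain {fraction D} :=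
  Subdomain localization_subring localization_frac.

End Localization.

(* Main.v *)
(* Extension of ideals gives homomorphisms [p_M : Inv(D) -> Inv(D_M)], each onto
   because invertible ideals of a local ring are principal, and jointly
   injective. In dimension one, [D / (x)] is zero-dimensional for [x != 0], so a
   basic open set [C] of the inverse topology is cut out on the primes
   containing [x] by an idempotent of [D / (x)]; gluing along that idempotent
   replaces any invertible [I] by an invertible ideal that is locally [I] on [C]
   and trivial off [C]. Moreover the support [{M | p_M I <> 0}] is compact.

   Scatteredness ranks the maximal ideals so that each [M] has a basic
   neighbourhood [U_M] in which all other points have smaller rank. As
   [Inv(D_M)] is free, [p_M] has a section [s_M] with values supported in
   [U_M]. The sum of the [s_M] is the isomorphism: it is triangular with respect
   to the rank, hence injective, and removing [s_M (p_M I)] from an ideal [I]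
   supported in [U_M] leaves an ideal with support of smaller rank, which
   compactness splits into finitely many pieces covered by induction. *)

Require Import Defs.
From HB Require Import structures.
From mathcomp Require Import all_boot all_order all_algebra.
From mathcomp Require Import all_classical topology.
From mathcomp Require Import ring.

Set Implicit Arguments.
Unset Strict Implicit.
Unset Printing Implicit Defensive.

Import GRing.Theory.

Local Open Scope ring_scope.
Local Open Scope classical_set_scope.

(** * Direct sums and free abelian groups *)

Lemma isomorphic_of_additive (G H : zmodType) (f : G -> H) :
  {morph f : x y / x - y} -> bijective f -> isomorphic G H.
Proof.
move=> fB fbij; pose fA := GRing.isZmodMorphism.Build G H f fB.
pose F : {additive G -> H} := HB.pack f fA.
by exists F.
Qed.

Lemma isomorphic_sym (G H : zmodType) : isomorphic G H -> isomorphic H G.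
Proof.
move=> [f [g fK gK]]; apply: (@isomorphic_of_additive _ _ g); last by exists f.
by move=> x y; rewrite -{1}[x]gK -{1}[y]gK -raddfB fK.
Qed.

Lemma isomorphic_trans (G H L : zmodType) :
  isomorphic G H -> isomorphic H L -> isomorphic G L.
Proof.
move=> [f fbij] [g gbij].
apply: (@isomorphic_of_additive _ _ (g \o f)); last exact: bij_comp.
by move=> x y /=; rewrite !raddfB.
Qed.

Lemma additive_zmod_closed (G H : zmodType) (f : G -> H) :
  {morph f : x y / x + y} -> {morph f : x y / x - y}.
Proof.
move=> fD x y; apply: (canRL (addrK _)); by rewrite -fD subrK.
Qed.

Section DirsumMap.
Variables (I : choiceType) (G : I -> zmodType) (H : zmodType).
Variable s : forall i, {additive G i -> H}.

(** The sum over all indices has finite support, as each [s i] sends 0 to 0, so it never takes the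
    default value of an infinite sum. *)
Definition dirsum_map (f : dirsum G) : H :=
  \sum_(i \in [set: I]) s i (f i).

Lemma dirsum_mapE (X : set I) (f : dirsum G) :
  (forall i, f i != 0 -> X i) -> finite_set X ->
  dirsum_map f = \sum_(i \in X) s i (f i).
Proof.
move=> fX Xfin; apply/esym/fsbig_widen => // i [_ /= Xi].
by have [->|/fX//] := eqVneq (f i) 0; rewrite raddf0.
Qed.

Lemma dirsum_map_is_zmod_morphism : {morph dirsum_map : f g / f - g}.
Proof.
apply: additive_zmod_closed => f g.
pose X := [set i | f i != 0] `|` [set i | g i != 0].
have Xfin : finite_set X by rewrite finite_setU; split; exact: dirsum_finite.
rewrite !(@dirsum_mapE X) //; [|by move=> i; right|by move=> i; left|].
  by rewrite -fsbig_split //; apply: eq_fsbigr => i _ /=; rewrite raddfD.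
move=> i /=; have [fi0|] := eqVneq (f i) 0; last by left.
by rewrite fi0 add0r; right.
Qed.

HB.instance Definition _ :=
  GRing.isZmodMorphism.Build (dirsum G) H dirsum_map dirsum_map_is_zmod_morphism.

Lemma dirsum_map_ind (P : H -> Prop) (f : dirsum G) :
  P 0 -> (forall x y, P x -> P y -> P (x + y)) ->
  (forall i, f i != 0 -> P (s i (f i))) -> P (dirsum_map f).
Proof.
move=> P0 PD Ps; rewrite (@dirsum_mapE [set i | f i != 0]) //; last first.
  exact: dirsum_finite.
rewrite fsbig_finite; last exact: dirsum_finite.
rewrite big_seq; apply: big_ind => // i.
rewrite in_fset_set; last exact: dirsum_finite.
by move=> /set_mem; exact: Ps.
Qed.

Lemma dirsum_map_raddf (L : zmodType) (p : {additive H -> L}) (f : dirsum G) :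
  p (dirsum_map f) = \sum_(i \in [set: I]) p (s i (f i)).
Proof.
rewrite (@dirsum_mapE [set i | f i != 0]) //; last exact: dirsum_finite.
rewrite fsbig_finite; last exact: dirsum_finite.
rewrite raddf_sum -fsbig_finite; last exact: dirsum_finite.
apply: fsbig_widen => // i [_ /=].
by have [->|//] := eqVneq (f i) 0; rewrite !raddf0.
Qed.

End DirsumMap.

Section DirsumDelta.
Variables (I : choiceType) (G : I -> zmodType).

Definition dirsum_coord (i : I) (f : dirsum G) : G i := f i.

HB.instance Definition _ i := GRing.isZmodMorphism.Build (dirsum G) (G i)
  (dirsum_coord i) (fun _ _ => erefl).

Lemma dirsum_delta_subproof i (x : G i) :
  finite_set [set j | dfwith (fun j => 0 : G j) i x j != 0].
Proof.
apply: (sub_finite_set _ (finite_set1 i)) => j /=.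
by case: dfwithP => [//|j' ij]; rewrite eqxx.
Qed.

Definition dirsum_delta i (x : G i) : dirsum G :=
  Dirsum (dirsum_delta_subproof x).

Lemma dirsum_delta_is_zmod_morphism i :
  {morph @dirsum_delta i : x y / x - y}.
Proof.
move=> x y; apply: dirsum_ext => j /=.
have [<-|ij] := eqVneq i j; first by rewrite !dfwithin.
by rewrite !dfwithout // subr0.
Qed.

HB.instance Definition _ i := GRing.isZmodMorphism.Build (G i) (dirsum G)
  (@dirsum_delta i) (@dirsum_delta_is_zmod_morphism i).

Lemma dirsum_map_delta (H : zmodType) (s : forall i, {additive G i -> H})
  i (x : G i) : dirsum_map s (dirsum_delta x) = s i x.
Proof.
rewrite (@dirsum_mapE _ _ _ _ [set i]); [|move=> j /=|exact: finite_set1].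
  by rewrite fsbig_set1 /= dfwithin.
by case: dfwithP => [//|j' ij]; rewrite eqxx.
Qed.

Lemma dirsum_map_deltaE (f : dirsum G) :
  dirsum_map (fun i => @dirsum_delta i : {additive _ -> _}) f = f.
Proof.
apply: dirsum_ext => j; rewrite -[LHS]/(dirsum_coord j _) dirsum_map_raddf.
rewrite -(@fsbig_widen _ _ _ _ [set j]) //; last first.
  by move=> i [_ /eqP ij]; rewrite /dirsum_coord /= dfwithout.
by rewrite fsbig_set1 /dirsum_coord /= dfwithin.
Qed.

Lemma raddf_dirsum (L : zmodType) (q : {additive dirsum G -> L}) f :
  q f = \sum_(i \in [set: I]) q (dirsum_delta (f i)).
Proof. by rewrite -{1}[f]dirsum_map_deltaE dirsum_map_raddf. Qed.

End DirsumDelta.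

(** Lift the basis elements of [G] into the subgroup [K] and extend by linearity. In the application
    [K] consists of the elements supported in a given neighbourhood. *)
Lemma free_abelian_section (H G : zmodType) (p : {additive H -> G})
  (K : H -> Prop) :
  free_abelian G -> K 0 -> (forall x y, K x -> K y -> K (x - y)) ->
  (forall g, exists2 h, K h & p h = g) ->
  exists s : {additive G -> H}, (forall g, K (s g)) /\ cancel s p.
Proof.
(* [{classic B'}] gives the basis the choice structure that [dirsum_map] asks of its index type. *)
move=> [B' [e]]; set B := {classic B'} => ebij.
pose Z (_ : B) : zmodType := int.
have {ebij} : bijective (e : G -> dirsum Z) by [].
case=> e' eK e'K K0 KB plift.
have KN x : K x -> K (- x) by rewrite -sub0r; exact: KB.
have KD x y : K x -> K y -> K (x + y) by rewrite -{2}[y]opprK => ? /KN; exact: KB.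
have Kmuln x n : K x -> K (x *+ n).
  by move=> Kx; elim: n => [|n IHn]; rewrite ?mulr0n // mulrS; exact: KD.
have Kmulz x (n : int) : K x -> K (x *~ n).
  by case: n => n Kx /=; [exact: Kmuln|exact/KN/Kmuln].
have /all_sig2[l Kl pl] (b : B) :
    {h | K h & p h = e' (dirsum_delta (G := Z) (i := b) (1 : int))}.
  by apply: cid2; exact: plift.
pose lz b := fun n : int => l b *~ n.
have lzB b : {morph lz b : x y / x - y} by move=> x y; rewrite /lz mulrzBr.
pose lA b : {additive int -> H} :=
  HB.pack (lz b) (GRing.isZmodMorphism.Build int H (lz b) (lzB b)).
pose t : {additive dirsum Z -> H} := @dirsum_map B Z H lA.
pose eA : {additive G -> dirsum Z} := e.
exists (t \o eA : {additive G -> H}); split.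
  move=> g /=; apply: dirsum_map_ind => // i _; exact: Kmulz.
move=> g /=; rewrite -{2}[g]eK -/(eA g); move: (eA g) => f {g}.
have e'B : {morph e' : x y / x - y}.
  by move=> x y; rewrite -{1}[x]e'K -{1}[y]e'K -(raddfB eA) eK.
pose e'A : {additive dirsum Z -> G} :=
  HB.pack e' (GRing.isZmodMorphism.Build _ _ e' e'B).
rewrite /t dirsum_map_raddf -[RHS]/(e'A f) raddf_dirsum; apply: eq_fsbigr => b _.
rewrite /= /lz raddfMz pl -[e' _]/(e'A _) -raddfMz; congr (e'A _).
by rewrite -raddfMz /= intz.
Qed.

(* [rho] ranks the indices along a well-founded order, and [U i] is a
   neighbourhood of [i] in which [i] has the largest rank. *)
Section RankedDecomposition.
Variables (I : choiceType) (G : I -> zmodType) (H : zmodType).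
Variable p : forall i, {additive H -> G i}.
Variables (T : Type) (R : T -> T -> Prop) (rho : I -> T) (U : I -> set I).

Definition support_in (C : set I) (h : H) := forall i, ~ C i -> p i h = 0.

Hypothesis Rwf : well_founded R.
Hypothesis Rtrans : forall x y z, R x y -> R y z -> R x z.
Hypothesis U_self : forall i, U i i.
Hypothesis U_rank : forall i j, U i j -> j <> i -> R (rho j) (rho i).
Hypothesis p_inj : forall h, (forall i, p i h = 0) -> h = 0.
Hypothesis p_restrict : forall i h, exists h',
  support_in (U i) h' /\ forall j, U i j -> p j h' = p j h.
Hypothesis p_surj : forall i g, exists h, p i h = g.
Hypothesis support_compact : forall h, exists2 s : seq I,
  (forall i, i \in s -> p i h <> 0) &
  support_in [set j | exists2 i, i \in s & U i j] h.
Hypothesis G_free : forall i, free_abelian (G i).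

(** A preimage from [p_surj] is cut down to [U i] by [p_restrict]; as [i] lies in [U i], its
    coordinate at [i] survives. *)
Let sections_exist i : exists s : {additive G i -> H},
  (forall g, support_in (U i) (s g)) /\ cancel s (p i).
Proof.
apply: free_abelian_section => //.
- by move=> j _; rewrite raddf0.
- by move=> x y Kx Ky j Uj; rewrite raddfB Kx // Ky // subrr.
move=> g; have [h <-] := p_surj g; have [h' [h'U h'p]] := p_restrict i h.
by exists h' => //; apply: h'p.
Qed.

Let s i : {additive G i -> H} := projT1 (cid (sections_exist i)).

Let s_supp i g : support_in (U i) (s i g).
Proof. by rewrite /s; case: cid => t [] /=. Qed.

Let sK i : cancel (s i) (p i).
Proof. by rewrite /s; case: cid => t [] /=. Qed.

Let exists_max (r : seq I) : r != [::] ->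
  exists2 m, m \in r & forall i, i \in r -> ~ R (rho m) (rho i).
Proof.
have Rirr x : ~ R x x by elim/(well_founded_ind Rwf): x => x IH /[dup]/IH.
elim: r => [//|i r IHr _].
have [->|/IHr[m mr mmax]] := eqVneq r [::].
  by exists i; rewrite ?mem_head // => j; rewrite inE => /eqP ->; exact: Rirr.
have [Rmi|nRmi] := pselect (R (rho m) (rho i)).
  exists i; rewrite ?mem_head // => j; rewrite inE => /orP[/eqP -> //|jr].
  by move=> Rij; apply: (mmax j jr); exact: Rtrans Rij.
exists m; first by rewrite inE mr orbT.
by move=> j; rewrite inE => /orP[/eqP -> //|]; exact: mmax.
Qed.

(** Let [m] have maximal rank in the support of [f]. No other [s i] contributes at [m], since [m] in
    [U i] would give [i] a larger rank; so coordinate [m] of the image is [f m]. *)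
Let s_inj : injective (dirsum_map s).
Proof.
apply: raddf_inj => f sf0; apply: contrapT => f0.
have /finite_seqP[X XE] := dirsum_finite f.
have memX i : (i \in X) = (f i != 0).
  by move/seteqP: XE => [fX Xf]; apply/idP/idP => [/Xf|/fX].
have [|m] := @exists_max X.
  apply/eqP => X0; apply: f0; apply: dirsum_ext => i /=.
  by apply/eqP; apply: contraT; rewrite -memX X0.
rewrite memX => /eqP fm0 mmax; apply: fm0.
rewrite -[RHS](raddf0 (p m)) -sf0 dirsum_map_raddf.
rewrite -(@fsbig_widen _ _ _ _ [set m]) //; last first.
  move=> i [_ /= im]; have [->|fi0] := eqVneq (f i) 0; first by rewrite !raddf0.
  apply: s_supp => Uim; apply: (mmax i); first by rewrite memX.
  by apply: U_rank => // mi; exact: im.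
by rewrite fsbig_set1 sK.
Qed.

Let im h := exists f, dirsum_map s f = h.

Let imD h1 h2 : im h1 -> im h2 -> im (h1 + h2).
Proof. by move=> [f <-] [g <-]; exists (f + g); rewrite raddfD. Qed.

(** Restricting to the sets of a finite cover, one after another, writes [h] as a sum of local
    pieces. The cover is centred in the support of [h], hence the condition on [i]. *)
Let im_local h :
  (forall i, p i h <> 0 -> forall h', support_in (U i) h' -> im h') -> im h.
Proof.
move=> loc; have [r r_supp] := support_compact h.
(* The induction on the list drops the support condition, since a remainder may vanish at later
   centres. *)
have {loc r_supp} : forall i, i \in r -> forall h', support_in (U i) h' -> im h'.
  by move=> i /r_supp; exact: loc.
elim: r h => [|i r IHr] h loc h_supp.
  exists 0; rewrite raddf0; apply/esym/p_inj => j; apply: h_supp.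
  by case=> ?; rewrite in_nil.
have [h' [h'U h'p]] := p_restrict i h.
rewrite -[h](subrKC h'); apply: imD; first by apply: (loc i) => //; exact: mem_head.
apply: IHr => [j jr|j jr]; first by apply: loc; rewrite inE jr orbT.
rewrite raddfB; have [Uij|nUij] := pselect (U i j).
  by rewrite h'p // subrr.
rewrite h'U // subr0; apply: h_supp => -[k]; rewrite inE => /orP[/eqP -> //|kr Ukj].
by apply: jr; exists k.
Qed.

(** Well-founded induction on the rank of [i], for elements supported in [U i]: subtracting
    [s i (p i h)] kills coordinate [i], and the other points of [U i] have smaller rank. *)
Let s_surj h : im h.
Proof.
apply: im_local => i _; move: {2}(rho i) (erefl (rho i)) => t.
elim/(well_founded_ind Rwf): t i {h} => t IHi i ti h hU.
rewrite -[h](subrKC (s i (p i h))); apply: imD.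
  by exists (dirsum_delta (p i h)); rewrite dirsum_map_delta.
apply: im_local => j pj; apply: (IHi (rho j)) => //; rewrite -ti.
apply: U_rank => [|ji]; last first.
  by apply: pj; rewrite ji raddfB sK subrr.
by apply: contrapT => nUj; apply: pj; rewrite raddfB hU // s_supp // subrr.
Qed.

Lemma ranked_decomposition : isomorphic H (dirsum G).
Proof.
apply: isomorphic_sym; exists (dirsum_map s : {additive _ -> _}).
have /all_sig[t tP] := fun h => cid (s_surj h).
exists t => [f|h]; last exact: tP.
by apply: s_inj; rewrite tP.
Qed.

End RankedDecomposition.

(** The disjoint union [C] of the bases is a basis: a finitely supported function on [C] is a family
    of such functions on the fibres, finitely many of them nonzero. *)
Lemma free_abelian_dirsum (I : choiceType) (G : I -> zmodType) :
  (forall i, free_abelian (G i)) -> free_abelian (dirsum G).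
Proof.
move=> Gfree; have /all_sig[B Biso] := fun i => cid (Gfree i).
pose Z i : zmodType := dirsum (fun _ : B i => (int : zmodType)).
have /all_sig2[e _ ebij] (i : I) : {e : {additive Z i -> G i} | True & bijective e}.
  by apply: cid2; have [e ebij] := isomorphic_sym (Biso i); exists e.
have /all_sig2[e' eK e'K] (i : I) : {e' | cancel (e i) e' & cancel e' (e i)}.
  by apply: cid2; case: (ebij i) => e'; exists e'.
pose C := {i : I & B i}; pose ZC : zmodType := dirsum (fun _ : C => (int : zmodType)).
have fib_fin (f : ZC) i : finite_set [set b : B i | f (existT _ i b) != 0].
  apply: (finite_preimage _ (dirsum_finite f)) => b b' _ _.
  exact: eq_from_Tagged.
pose fib (f : ZC) i : Z i := Dirsum (fib_fin f i).
have phi_fin (f : ZC) : finite_set [set i | e i (fib f i) != 0].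
  apply: (sub_finite_set _ (finite_image (@projT1 _ _) (dirsum_finite f))).
  move=> i /=; apply: contraNP => fi; apply/eqP.
  suff -> : fib f i = 0 by rewrite raddf0.
  apply: dirsum_ext => b /=; apply: contrapT => /eqP fb.
  by apply: fi; exists (existT _ i b).
pose phi (f : ZC) : dirsum G := Dirsum (phi_fin f).
have psi_fin (g : dirsum G) :
    finite_set [set c : C | e' (projT1 c) (g (projT1 c)) (projT2 c) != 0].
  apply: (@sub_finite_set _ _ (\bigcup_(i in [set i | g i != 0])
    existT _ i @` [set b | e' i (g i) b != 0])).
    move=> [i b] /= gb; exists i; last by exists b.
    apply: contraNneq gb => /= ->.
    by rewrite -(raddf0 (e i)) eK.
  apply: bigcup_finite => [|i _]; first exact: dirsum_finite.
  exact/finite_image/dirsum_finite.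
pose psi (g : dirsum G) : ZC := Dirsum (psi_fin g).
exists C; apply: isomorphic_sym.
apply: (@isomorphic_of_additive ZC (dirsum G) phi).
  move=> f g; apply: dirsum_ext => i; rewrite [LHS]/= [RHS]/= -raddfB.
  by congr (e i _); exact: dirsum_ext.
exists psi => [f|g]; first by apply: dirsum_ext => -[i b] /=; rewrite eK.
by apply: dirsum_ext => i /=; rewrite -[RHS]e'K; congr (e i _); exact: dirsum_ext.
Qed.
(** * Ideals of a one-dimensional domain *)

Section RingIdeals.
Variable D : idomainType.
Implicit Types (J L S : set D) (P M N : Spec D).

(** Unlike [idealr_closed], this allows the unit ideal, which [ideal_adjoin] may produce. *)
Definition ring_ideal J := J 0 /\ forall a u v, J u -> J v -> J (a * u + v).

Lemma ring_idealM J a u : ring_ideal J -> J u -> J (a * u).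
Proof. by move=> [J0 JD] Ju; rewrite -[_ * _]addr0; exact: JD. Qed.

Lemma ring_idealD J u v : ring_ideal J -> J u -> J v -> J (u + v).
Proof. by move=> [_ JD] Ju Jv; rewrite -[u]mul1r; exact: JD. Qed.

Lemma idealr_closedP J : idealr_closed [in J] <-> ring_ideal J /\ ~ J 1.
Proof.
split=> [[/set_mem J0 /negP J1 JD]|[[J0 JD] J1]].
  split; last by move=> ?; apply/J1/mem_set.
  by split=> // a u v Ju Jv; apply/set_mem/JD; exact: mem_set.
split; [exact: mem_set|by apply/negP => /set_mem|].
by move=> a u v /set_mem Ju /set_mem Jv; apply/mem_set/JD.
Qed.

Lemma Spec_ring_ideal P : ring_ideal P.
Proof. by have /idealr_closedP[] := Spec_ideal P. Qed.

Lemma Spec_not1 P : ~ Spec_set P 1.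
Proof. by have /idealr_closedP[] := Spec_ideal P. Qed.

Lemma SpecM P u v : Spec_set P (u * v) -> Spec_set P u \/ Spec_set P v.
Proof. by move=> /mem_set/Spec_prime/orP[] /set_mem; [left|right]. Qed.

Lemma Spec_exp P u n : Spec_set P (u ^+ n) -> Spec_set P u.
Proof.
elim: n => [|n IHn]; first by rewrite expr0 => /Spec_not1.
by rewrite exprS => /SpecM[].
Qed.

Lemma SpecD P u v : Spec_set P u -> Spec_set P v -> Spec_set P (u + v).
Proof. by apply: ring_idealD; exact: Spec_ring_ideal. Qed.

Lemma SpecMl P a u : Spec_set P u -> Spec_set P (a * u).
Proof. by apply: ring_idealM; exact: Spec_ring_ideal. Qed.

Definition ideal_adjoin J (u : D) : set D :=
  [set z | exists2 p, J p & exists a, z = p + a * u].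

Lemma ideal_adjoin_ideal J u : ring_ideal J -> ring_ideal (ideal_adjoin J u).
Proof.
move=> [J0 JD]; split; first by exists 0 => //; exists 0; rewrite mul0r addr0.
move=> c _ _ [p Jp [a ->]] [q Jq [b ->]].
exists (c * p + q); first exact: JD.
by exists (c * a + b); rewrite mulrDr mulrDl mulrA addrACA.
Qed.

Lemma sub_ideal_adjoin J u : J `<=` ideal_adjoin J u.
Proof. by move=> p Jp; exists p => //; exists 0; rewrite mul0r addr0. Qed.

Lemma ideal_adjoin_mem J u : ring_ideal J -> ideal_adjoin J u u.
Proof. by move=> [J0 _]; exists 0 => //; exists 1; rewrite mul1r add0r. Qed.

Lemma exists_ideal_maximal_avoiding J S :
  ring_ideal J -> (forall u, S u -> ~ J u) ->
  exists L, [/\ ring_ideal L, J `<=` L, forall u, S u -> ~ L u &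
    forall L', ring_ideal L' -> (forall u, S u -> ~ L' u) -> L `<=` L' ->
      L' = L].
Proof.
move=> Ji JS; pose Q L := [/\ ring_ideal L, J `<=` L & forall u, S u -> ~ L u].
(* [set0] is allowed so that the empty chain has an upper bound. *)
have [F FQ Ftot|L [QL Lmax]] := @Zorn_bigcup D [set L | L = set0 \/ Q L].
  have [F0|/set0P[x [X0 FX0 X0x]]] := eqVneq (\bigcup_(X in F) X) set0.
    by left.
  have FQ' X u : F X -> X u -> Q X.
    by move=> FX Xu; case: (FQ X FX) => // X_0; rewrite X_0 in Xu.
  have [[X00 _] JX0 _] := FQ' _ _ FX0 X0x.
  right; split.
  - split=> [|a u v [X FX Xu] [Y FY Yv]]; first by exists X0.
    have [[_ XD] _ _] := FQ' _ _ FX Xu; have [[_ YD] _ _] := FQ' _ _ FY Yv.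
    have [XY|YX] := Ftot _ _ FX FY.
      by exists Y => //; apply: YD => //; exact: XY.
    by exists X => //; apply: XD => //; exact: YX.
  - by move=> u Ju; exists X0 => //; exact: JX0.
  - by move=> u Su [X FX Xu]; have [_ _] := FQ' _ _ FX Xu; apply; last exact: Xu.
(* [L] is not [set0]: [J] contains 0 and would be strictly larger. *)
case: QL => [L0|[Li JL LS]].
  have J0 : J 0 by case: Ji.
  by case: (Lmax J); [rewrite L0 properEneq; split=> //; apply/eqP => J_0;
    rewrite -J_0 in J0|right; split].
exists L; split=> // L' L'i L'S LL'; apply: contrapT => /eqP L'L.
apply: (Lmax L'); first by rewrite properEneq eq_sym.
by right; split=> //; exact: subset_trans JL LL'.
Qed.

(** An ideal maximal among those disjoint from a multiplicative set is prime. Maximality stays in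
    the conclusion so that the choice [S = {1}] yields maximal ideals. *)
Lemma exists_prime_avoiding J S :
  ring_ideal J -> S 1 -> (forall u v, S u -> S v -> S (u * v)) ->
  (forall u, S u -> ~ J u) ->
  exists P : Spec D, [/\ J `<=` P, forall u, S u -> ~ Spec_set P u &
    forall L, ring_ideal L -> (forall u, S u -> ~ L u) -> P `<=` L -> L = P].
Proof.
move=> Ji S1 SM JS; have [L [Li JL LS Lmax]] := exists_ideal_maximal_avoiding Ji JS.
have Lclosed : idealr_closed [in L].
  by apply/idealr_closedP; split=> //; exact: LS.
suff Lprime : prime_idealr_closed [in L] by exists (MkSpec Lclosed Lprime).
have adjS u : u \notin L -> exists s, S s /\ ideal_adjoin L u s.
  move=> /negP Lu; apply: contrapT => nS; apply/Lu/mem_set.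
  rewrite -(Lmax (ideal_adjoin L u)); first exact: ideal_adjoin_mem.
  - exact: ideal_adjoin_ideal.
  - by move=> s Ss us; apply: nS; exists s.
  - exact: sub_ideal_adjoin.
move=> u v /set_mem Luv; apply/orP; apply: contrapT => /not_orP[/negP Lu /negP Lv].
(* [L + (u)] and [L + (v)] both meet [S], and the product of the two elements found there lies in
   [L] because [u * v] does. *)
have [s [Ss [p Lp [a Es]]]] := adjS _ Lu.
have [t [St [q Lq [b Et]]]] := adjS _ Lv.
apply: (LS _ (SM _ _ Ss St)).
have -> : s * t = t * p + (a * u * q + a * b * (u * v)).
  by rewrite Es Et; ring.
do 2?[apply: ring_idealD => //]; exact: ring_idealM.
Qed.

Lemma exists_maximal J : ring_ideal J -> ~ J 1 -> exists2 M, MaxSpec M & J `<=` M.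
Proof.
move=> Ji J1; have [//|||P [JP _ Pmax]] := @exists_prime_avoiding J [set 1] Ji.
- by move=> _ _ -> ->; rewrite mulr1.
- by move=> _ ->.
exists P => // L /idealr_closedP[Li L1] PL.
by apply: Pmax => // u ->.
Qed.

Lemma zero_spec_exists : exists P : Spec D, Spec_set P = [set 0].
Proof.
have zi : ring_ideal [set 0 : D].
  by split=> // a u v /= -> ->; rewrite mulr0 addr0.
have zc : idealr_closed [in [set 0 : D]].
  by apply/idealr_closedP; split=> //=; exact/eqP/oner_neq0.
suff zp : prime_idealr_closed [in [set 0 : D]] by exists (MkSpec zc zp).
by move=> u v /set_mem/= /eqP; rewrite mulf_eq0 => /orP[/eqP->|/eqP->];
  apply/orP; [left|right]; exact/mem_set.
Qed.

(** Otherwise [P + (y)] lies in a maximal ideal [M], and 0 < P < M is a chain too long for dimension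
    one; [x] makes the first inclusion strict. *)
Lemma dim1_prime_maximal (P : Spec D) x y : krull_dim_eq D 1 ->
  x != 0 -> Spec_set P x -> ~ Spec_set P y ->
  exists a, Spec_set P (1 - a * y).
Proof.
move=> [_ dimD] x0 Px Py; apply: contrapT => nP.
have [|p1|M _ PM] := @exists_maximal (ideal_adjoin P y).
- exact/ideal_adjoin_ideal/Spec_ring_ideal.
- by case: p1 => p Pp [a a1]; apply: nP; exists a; rewrite a1 addrK.
have [Z ZE] := zero_spec_exists.
have ZP : Z `<` P.
  rewrite ZE; split=> [_ ->|/(_ x Px)/= x_0]; last by rewrite x_0 eqxx in x0.
  by case: (Spec_ring_ideal P).
have PM' : P `<` M.
  split=> [u Pu|/(_ y) MP]; first exact/PM/sub_ideal_adjoin.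
  by apply/Py/MP/PM/ideal_adjoin_mem/Spec_ring_ideal.
pose c (i : 'I_3) := if val i is 0 then Z else if val i is 1 then P else M.
suff /dimD : prime_chain c by [].
move=> [[|[|[|//]]] ?] [[|[|[|//]]] ?] //= _; rewrite /c //=.
case: ZP PM' => ZP _ [{}PM MP]; split; first exact: subset_trans ZP PM.
by move=> MZ; apply: MP; exact: subset_trans MZ ZP.
Qed.

(* [D / (x)] is zero-dimensional, so [y ^+ n] is a multiple of [y ^+ n.+1]
   modulo [x] for some [n > 0], and [(y * r) ^+ n] is idempotent there. *)
Lemma dim1_idempotent x y : krull_dim_eq D 1 -> x != 0 ->
  exists e r : D, e * (1 - e) = x * r /\
    forall P : Spec D, Spec_set P x -> (Spec_set P y <-> ~ Spec_set P e).
Proof.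
move=> dimD x0.
pose J := [set z | exists r, z = x * r].
have Ji : ring_ideal J.
  split; first by exists 0; rewrite mulr0.
  by move=> a _ _ [r ->] [t ->]; exists (a * r + t); ring.
pose S := [set z | exists n r, z = y ^+ n * (1 - y * r)].
(* No prime [P] containing [x] is disjoint from [S]: [y] is in [S], and if [y] is not in [P], then
   [P] contains some [1 - a * y], which is also in [S]. *)
have [n [r [t yn]]] : exists n r, J (y ^+ n * (1 - y * r)).
  apply: contrapT => nJ.
  have [||||P [JP PS _]] := @exists_prime_avoiding J S => //.
  - by exists 0%N, 0; rewrite mulr0 subr0 mulr1.
  - move=> _ _ [n [r ->]] [m [t ->]]; exists (n + m)%N, (r + t - y * r * t).
    by rewrite exprD; ring.
  - by move=> _ [n [r ->]] Jz; apply: nJ; exists n, r.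
  have [Py|Py] := pselect (Spec_set P y).
    by apply: (PS y) => //; exists 1%N, 0; rewrite mulr0 subr0 mulr1.
  have [|a Pa] := dim1_prime_maximal dimD x0 _ Py.
    by apply: JP; exists 1; rewrite mulr1.
  by apply: (PS _ _ Pa); exists 0%N, a; rewrite expr0 mul1r mulrC.
(* The exponent [n.+1] leaves a factor [y] beside [y ^+ n]: the power makes [f * (1 - f)] a multiple
   of [x], and the spare [y] puts [f] in every prime containing [y], even for [n = 0]. *)
pose f := (y * r) ^+ n.+1.
have yf m : exists s, y ^+ n * (1 - (y * r) ^+ m) = x * s.
  elim: m => [|m [s IH]]; first by exists 0; rewrite expr0 subrr !mulr0.
  exists (s * (y * r) + t).
  have -> : x * (s * (y * r) + t) = y * r * (x * s) + x * t by ring.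
  by rewrite -IH -yn exprS; ring.
have [s fs] := yf n.+1.
have {yn yf} fE : f = y * r ^+ n.+1 * y ^+ n.
  by rewrite /f exprMn exprS mulrAC.
have ff : f * (1 - f) = x * (y * r ^+ n.+1 * s).
  by rewrite {1}fE -mulrA fs mulrCA.
(* Among primes containing [x], those containing [f] are those containing [y], so the complement of
   [f] is the required [e]. *)
exists (1 - f), (y * r ^+ n.+1 * s); split; first by rewrite subKr mulrC.
move=> P Px; have Pxz z : Spec_set P (x * z) by rewrite mulrC; exact: SpecMl.
have P1 : Spec_set P f -> ~ Spec_set P (1 - f).
  by move=> Pf Pe; apply: (@Spec_not1 P); rewrite -[1](subrK f); exact: SpecD.
split=> [Py|Pe].
  by apply: P1; rewrite fE -mulrA mulrC; exact: SpecMl.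
have Pf : Spec_set P f by have [] : Spec_set P f \/ Spec_set P (1 - f);
  [apply: SpecM; rewrite ff|..].
by have [/Spec_exp|] : Spec_set P (y ^+ n) \/ Spec_set P (1 - f);
  [apply: SpecM; rewrite fs|..].
Qed.

End RingIdeals.

(** * Invertible ideals and localization *)

Section Extension.
Variables (K : fieldType) (A B : subdomain K).
Hypothesis sAB : A `<=` B.
Implicit Types I J : set K.

Lemma fractional_extension I :
  fractional_ideal A I -> fractional_ideal B (ideal_mul I B).
Proof.
move=> Ifr; split; [exact: ideal_mul0|exact: ideal_mulD| |].
  move=> b z Bb; elim/ideal_mul_ind => [|x y|x y Ix By].
  - by rewrite mulr0; exact: ideal_mul0.
  - by rewrite mulrDr; exact: ideal_mulD.
  - by rewrite mulrCA; apply: ideal_mul_gen => //; exact: subdomainM.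
have [d [Ad d0 dI]] := fideal_denom Ifr.
exists d; split=> //; first exact: sAB.
move=> z; elim/ideal_mul_ind => [|x y|x y Ix By].
- by rewrite mulr0; exact: subdomain0.
- by rewrite mulrDr; exact: subdomainD.
- by rewrite mulrA; apply: subdomainM => //; exact/sAB/dI.
Qed.

(** Since [B B = B], each of [I] and [J] can be given its own factor [B]. *)
Lemma ideal_mul_extension I J :
  ideal_mul (ideal_mul I J) B = ideal_mul (ideal_mul I B) (ideal_mul J B).
Proof.
rewrite -{1}(ideal_mul1 (fractional_subdomain B)) !ideal_mulA; congr ideal_mul.
by rewrite -!ideal_mulA (ideal_mulC J).
Qed.

Lemma ideal_mul_sub : ideal_mul A B = B.
Proof.
apply/seteqP; split=> [|b Bb]; last first.
  by rewrite -[b]mul1r; apply: ideal_mul_gen => //; exact: subdomain1.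
apply: ideal_mul_ind; [exact: subdomain0|exact: subdomainD|].
by move=> x y /sAB Bx By; exact: subdomainM.
Qed.

Lemma invertible_extension I : invertible A I -> invertible B (ideal_mul I B).
Proof.
move=> [Ifr [J Jfr IJ]]; split; first exact: fractional_extension.
exists (ideal_mul J B); first exact: fractional_extension.
by rewrite -ideal_mul_extension IJ ideal_mul_sub.
Qed.

Definition Inv_extension (I : InvGroup A) : InvGroup B :=
  MkInv (invertible_extension (InvP I)).

Lemma Inv_extension_is_zmod_morphism : {morph Inv_extension : I J / I - J}.
Proof.
apply: additive_zmod_closed => I J; apply: Inv_ext; exact: ideal_mul_extension.
Qed.

HB.instance Definition _ :=
  GRing.isZmodMorphism.Build (InvGroup A) (InvGroup B)
    Inv_extension Inv_extension_is_zmod_morphism.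

End Extension.

(** * Duality and restriction of invertible ideals *)

Section InvertibleIdeals.
Variables (K : fieldType) (A : subdomain K).
Implicit Types I J : set K.

Lemma InvD_set (I J : InvGroup A) : (I + J : InvGroup A) = ideal_mul I J :> set K.
Proof. by []. Qed.

Lemma Inv_oppK (I : InvGroup A) :
  ideal_mul I (- I : InvGroup A) = A.
Proof. by rewrite -InvD_set subrr. Qed.

Lemma Inv_mul_opp (I : InvGroup A) x y :
  Inv_set I x -> Inv_set (- I) y -> subdomain_set A (x * y).
Proof. by move=> Ix Iy; rewrite -(Inv_oppK I); exact: ideal_mul_gen. Qed.

(** Write 1 as a sum of products [y * z] with [y] in [I] and [z] in [J]; then [x] is the sum of the
    [(x * z) * y]. *)
Lemma mem_ideal_of_inverse I J x : fractional_ideal A I ->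
  ideal_mul I J = A -> (forall y, J y -> subdomain_set A (x * y)) -> I x.
Proof.
move=> Ifr IJ xJ; rewrite -[x]mulr1.
have : ideal_mul I J 1 by rewrite IJ; exact: subdomain1.
elim/ideal_mul_ind => [|y z|y z Iy Jz].
- by rewrite mulr0; exact: fideal0 Ifr.
- by rewrite mulrDr; apply: (fidealD Ifr).
- by rewrite mulrCA mulrC; apply: (fidealM Ifr) => //; exact: xJ.
Qed.

Definition principal (x : K) : set K :=
  [set z | exists2 a, subdomain_set A a & z = x * a].

Lemma fractional_principal x : x != 0 -> fractional_ideal A (principal x).
Proof.
move=> x0; split.
- by exists 0; [exact: subdomain0|rewrite mulr0].
- move=> _ _ [a Aa ->] [b Ab ->]; exists (a + b); first exact: subdomainD.
  by rewrite mulrDr.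
- move=> c _ Ac [a Aa ->]; exists (c * a); first exact: subdomainM.
  by rewrite mulrCA.
have [a [b [Aa Ab b0 xE]]] := subdomain_frac A x.
exists b; split=> // _ [c Ac ->]; rewrite xE mulrA mulrCA mulfV // mulr1.
exact: subdomainM.
Qed.

Lemma invertible_principal x : x != 0 -> invertible A (principal x).
Proof.
move=> x0; split; first exact: fractional_principal.
exists (principal x^-1); first by apply: fractional_principal; rewrite invr_eq0.
apply/seteqP; split=> [|a Aa].
  apply: ideal_mul_ind; [exact: subdomain0|exact: subdomainD|].
  by move=> _ _ [a Aa ->] [b Ab ->]; rewrite mulrACA mulfV // mul1r; exact: subdomainM.
rewrite -[a]mul1r -(mulfV x0) -mulrA; apply: ideal_mul_gen.
  by exists 1; [exact: subdomain1|rewrite mulr1].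
by exists a.
Qed.

Section Restriction.
Variables (e x r : K).
Hypotheses (Ae : subdomain_set A e) (Ax : subdomain_set A x) (x0 : x != 0).
Hypotheses (Ar : subdomain_set A r) (er : e * (1 - e) = x * r).

(* Modulo [x], [e] is idempotent. The ideal [e I + (1 - e) A] agrees with [I]
   where [e] is a unit and with [A] where [1 - e] is one. *)
Definition restriction I : set K :=
  [set z | exists2 i, I i & exists2 a, subdomain_set A a &
    z = e * i + (1 - e) * a].

Let A1e : subdomain_set A (1 - e).
Proof. by apply: subdomainB => //; exact: subdomain1. Qed.

Lemma fractional_restriction I : fractional_ideal A I ->
  (forall i, I i -> subdomain_set A (x * i)) ->
  fractional_ideal A (restriction I).
Proof.
move=> Ifr xI; split.
- exists 0; [exact: fideal0 Ifr|exists 0; first exact: subdomain0].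
  by rewrite !mulr0 addr0.
- move=> _ _ [i Ii [a Aa ->]] [j Ij [b Ab ->]].
  exists (i + j); [by apply: (fidealD Ifr)|exists (a + b); first exact: subdomainD].
  by rewrite !mulrDr addrACA.
- move=> c _ Ac [i Ii [a Aa ->]].
  exists (c * i); [by apply: (fidealM Ifr)|exists (c * a); first exact: subdomainM].
  by rewrite mulrDr !(mulrCA c).
- exists x; split=> // _ [i Ii [a Aa ->]]; rewrite mulrDr mulrCA.
  apply: subdomainD; first by apply: subdomainM => //; exact: xI.
  by do 2?[apply: subdomainM => //].
Qed.

(** Cross terms carry the factor [e * (1 - e) = x * r], and [x] clears their denominators.
    Conversely the product contains the squares of [e] and [1 - e], which are comaximal. *)
Lemma restriction_mul I J : fractional_ideal A I -> fractional_ideal A J ->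
  (forall i, I i -> subdomain_set A (x * i)) ->
  (forall j, J j -> subdomain_set A (x * j)) ->
  ideal_mul I J = A -> ideal_mul (restriction I) (restriction J) = A.
Proof.
move=> Ifr Jfr xI xJ IJ; apply/seteqP; split.
  apply: ideal_mul_ind; [exact: subdomain0|exact: subdomainD|].
  move=> _ _ [i Ii [a Aa ->]] [j Jj [b Ab ->]].
  have -> : (e * i + (1 - e) * a) * (e * j + (1 - e) * b) =
      e * e * (i * j) + (e * (1 - e)) * (a * j + b * i)
      + (1 - e) * (1 - e) * (a * b) by ring.
  rewrite er; have -> : x * r * (a * j + b * i) =
      r * (a * (x * j) + b * (x * i)) by ring.
  have Aij : subdomain_set A (i * j) by rewrite -IJ; exact: ideal_mul_gen.
  have Axj := xJ j Jj; have Axi := xI i Ii.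
  by do ?[assumption|apply: subdomainD|apply: subdomainM].
have [rI rJ] := (fractional_restriction Ifr xI, fractional_restriction Jfr xJ).
have rfr := fractional_mul rI rJ.
have ee : ideal_mul (restriction I) (restriction J) (e * e).
  have : ideal_mul I J 1 by rewrite IJ; exact: subdomain1.
  rewrite -[e * e]mulr1; elim/ideal_mul_ind => [|u v|i j Ii Jj].
  - by rewrite mulr0; exact: ideal_mul0.
  - by rewrite mulrDr; exact: ideal_mulD.
  - rewrite mulrACA; apply: ideal_mul_gen.
      exists i => //; exists 0; [exact: subdomain0|by rewrite mulr0 addr0].
    exists j => //; exists 0; [exact: subdomain0|by rewrite mulr0 addr0].
have ff : ideal_mul (restriction I) (restriction J) ((1 - e) * (1 - e)).
  apply: ideal_mul_gen.
    by exists 0; [exact: fideal0 Ifr|exists 1; [exact: subdomain1|rewrite mulr0 add0r mulr1]].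
  by exists 0; [exact: fideal0 Jfr|exists 1; [exact: subdomain1|rewrite mulr0 add0r mulr1]].
move=> a Aa; rewrite -[a]mulr1.
(* This is [(3 - 2e) e^2 + (1 + 2e) (1 - e)^2 = 1], scaled by [a]. *)
have -> : a * 1 = a * (1 + (1 - e) + (1 - e)) * (e * e) +
    a * (1 + e + e) * ((1 - e) * (1 - e)) by ring.
have A1 := subdomain1 A.
by apply: (fidealD rfr); apply: (fidealM rfr) => //;
  do ?[assumption|apply: subdomainM|apply: subdomainD].
Qed.

End Restriction.

(** One [x] serves both ideals, so that both can be restricted along the same [e]. Over [D] it also
    confines the support of [I] to the primes containing [x]. *)
Lemma Inv_denom (I : InvGroup A) : exists x, [/\ subdomain_set A x, x != 0,
  forall i, Inv_set I i -> subdomain_set A (x * i) &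
  forall i, Inv_set (- I) i -> subdomain_set A (x * i)].
Proof.
have [d [Ad d0 dI]] := fideal_denom (proj1 (InvP I)).
have [d' [Ad' d'0 d'I]] := fideal_denom (proj1 (InvP (- I))).
exists (d * d'); split; [exact: subdomainM|exact: mulf_neq0| |].
  by move=> i Ii; rewrite mulrAC mulrC; apply: subdomainM => //; exact: dI.
by move=> i Ii; rewrite -mulrA; apply: subdomainM => //; exact: d'I.
Qed.

End InvertibleIdeals.

(** * Localization of invertible ideals at primes *)

Section Localization.
Variable D : idomainType.
Implicit Types (P M N : Spec D) (I J : set {fraction D}).

Local Notation "x %:F" := (@FracField.tofrac D x).

Lemma domain_sub_localization P : domain D `<=` localization P.
Proof.
move=> _ [a _ <-]; exists a, 1; split; first exact: Spec_not1.
by rewrite tofrac1 divr1.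
Qed.

Definition Inv_localize P :
    {additive InvGroup (domain D) -> InvGroup (localization P)} :=
  Inv_extension (@domain_sub_localization P).

Lemma mem_extension_localization P I z : fractional_ideal (domain D) I ->
  ideal_mul I (localization P) z <-> exists2 s, ~ Spec_set P s & I (s%:F * z).
Proof.
move=> Ifr; split.
  elim/ideal_mul_ind => [|u v [s Ps Isu] [t Pt Itv]|i _ Ii [a [s [Ps ->]]]].
  - by exists 1; [exact: Spec_not1|rewrite mulr0; exact: fideal0 Ifr].
  - exists (s * t); first exact: Spec_complM.
    have -> : (s * t)%:F * (u + v) = t%:F * (s%:F * u) + s%:F * (t%:F * v).
      by rewrite tofracM; ring.
    by apply: (fidealD Ifr); apply: (fidealM Ifr) => //; [exists t|exists s].
  - exists s => //; rewrite mulrCA (mulrC s%:F) divfK ?(Spec_compl_neq0 Ps) // mulrC.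
    by apply: (fidealM Ifr) => //; exists a.
move=> [s Ps Isz].
rewrite -[z](mulKf (Spec_compl_neq0 Ps)) mulrC.
apply: ideal_mul_gen => //; exists 1, s; split=> //.
by rewrite tofrac1 mul1r.
Qed.

Lemma extension_localization_le P I J :
  fractional_ideal (domain D) I -> fractional_ideal (domain D) J ->
  (forall z, I z -> exists2 s, ~ Spec_set P s & J (s%:F * z)) ->
  ideal_mul I (localization P) `<=` ideal_mul J (localization P).
Proof.
move=> Ifr Jfr IJ z /(mem_extension_localization _ _ Ifr)[s Ps Isz].
apply/mem_extension_localization => //; have [t Pt Jt] := IJ _ Isz.
by exists (t * s); [exact: Spec_complM|rewrite tofracM -mulrA].
Qed.

(** [s] becomes a unit at [P]. The first bound gives one inclusion; the second, by duality, puts [s]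
    in [I] and gives the other. *)
Lemma localize_eq0 P (I : InvGroup (domain D)) s : ~ Spec_set P s ->
  (forall i, Inv_set I i -> domain_set (s%:F * i)) ->
  (forall i, Inv_set (- I) i -> domain_set (s%:F * i)) ->
  Inv_localize P I = 0.
Proof.
move=> Ps sI sI'; apply: Inv_ext; rewrite -(raddf0 (Inv_localize P)).
have Ifr := proj1 (InvP I).
apply/seteqP; split; apply: extension_localization_le => //;
  try exact: fractional_subdomain.
  by move=> z Iz; exists s => //; exact: sI.
move=> z Dz; exists s => //; rewrite mulrC; apply: (fidealM Ifr) => //.
exact: mem_ideal_of_inverse Ifr (Inv_oppK I) sI'.
Qed.

(** Triviality at [P] puts some [s] outside [P] into [I], so [s] clears the denominators of the
    inverse. The same argument for the inverse gives [t], and [s * t] serves for both. *)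
Lemma localize_eq0_nbhd P (I : InvGroup (domain D)) : Inv_localize P I = 0 ->
  exists2 s, ~ Spec_set P s & forall N, ~ Spec_set N s -> Inv_localize N I = 0.
Proof.
have half (J : InvGroup (domain D)) : Inv_localize P J = 0 ->
    exists2 s, ~ Spec_set P s &
      forall i, Inv_set (- J) i -> domain_set (s%:F * i).
  move=> J0; have [|s Ps Js] := (mem_extension_localization P 1 (proj1 (InvP J))).1.
    rewrite -[ideal_mul _ _]/(Inv_set (Inv_localize P J)) J0.
    exact: (subdomain1 (localization P)).
  exists s => // i; rewrite mulr1 in Js; exact: Inv_mul_opp Js.
move=> I0; have [s Ps sI] := half _ I0.
have [|t Pt tI] := half (- I); first by rewrite raddfN I0 oppr0.
rewrite opprK in tI; exists (s * t); first exact: Spec_complM.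
move=> N Nst; apply: (localize_eq0 Nst) => i Ii; rewrite tofracM.
  by rewrite -mulrA; apply: (@subdomainM _ (domain D)); [exists s|exact: tI].
by rewrite mulrAC mulrC; apply: (@subdomainM _ (domain D)); [exists t|exact: sI].
Qed.

Lemma localize_inj (I : InvGroup (domain D)) :
  (forall M, MaxSpec M -> Inv_localize M I = 0) -> I = 0.
Proof.
move=> I0.
have sub (J L : set {fraction D}) : fractional_ideal (domain D) J ->
    fractional_ideal (domain D) L ->
    (forall M, MaxSpec M ->
      ideal_mul J (localization M) `<=` ideal_mul L (localization M)) ->
    J `<=` L.
  move=> Jfr Lfr JL z Jz; apply: contrapT => Lz.
  (* The local inclusions put into this conductor ideal an element outside each maximal ideal, so it
     cannot be proper. *)
  pose C := [set s | L (s%:F * z)].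
  have Ci : ring_ideal C.
    split; first by rewrite /C /= tofrac0 mul0r; exact: fideal0 Lfr.
    move=> a u v; rewrite /C /= => Lu Lv.
    rewrite tofracD tofracM mulrDl -mulrA; apply: (fidealD Lfr) => //.
    by apply: (fidealM Lfr) => //; exists a.
  have [|M Mmax CM] := exists_maximal Ci; first by rewrite /C /= tofrac1 mul1r.
  have [|s Ms Ls] := (mem_extension_localization M z Lfr).1.
    apply: JL => //; rewrite -[z]mulr1; apply: ideal_mul_gen => //.
    exact: subdomain1.
  exact/Ms/CM.
have Ifr := proj1 (InvP I); have Dfr := fractional_subdomain (domain D).
have E M : MaxSpec M ->
    ideal_mul I (localization M) = ideal_mul (domain D) (localization M).
  move=> /I0 IM; rewrite (ideal_mul_sub (@domain_sub_localization M)).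
  by move: IM => /(congr1 (@Inv_set _ _)).
by apply: Inv_ext; apply/seteqP; split; apply: sub => // M /E ->.
Qed.

(** In a local ring some product [x * y], with [x] in [I] and [y] in its inverse, is a unit, since
    sums of nonunits are nonunits. Then [x] generates [I], and the ideal that [x] generates over [D]
    extends to [I]. *)
Lemma localize_surj P (I : InvGroup (localization P)) :
  exists J : InvGroup (domain D), Inv_localize P J = I.
Proof.
pose L := localization P.
pose nonunit := [set z : {fraction D} | exists a s,
  [/\ Spec_set P a, ~ Spec_set P s & z = a%:F / s%:F]].
have [x [y [Ix Iy [xy0 xyV]]]] : exists x y,
    [/\ Inv_set I x, Inv_set (- I) y & x * y != 0 /\ subdomain_set L (x * y)^-1].
  apply: contrapT => nu.
  have : ideal_mul I (- I : InvGroup L) 1 by rewrite Inv_oppK; exact: subdomain1.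
  suff : forall z, ideal_mul I (- I : InvGroup L) z -> nonunit z.
    move=> /[apply] -[a [s [Pa Ps]]]; have s0 := Spec_compl_neq0 Ps.
    rewrite -[1](mulfV s0) => /(mulIf _) sa.
    apply: Ps; have /eqP : s%:F = a%:F by apply: sa; rewrite invr_eq0.
    by rewrite tofrac_eq => /eqP ->.
  move=> z; elim/ideal_mul_ind => [|u v [a [s [Pa Ps ->]]] [b [t [Pb Pt ->]]]|i j Ii Jj].
  - exists 0, 1; split; [by case: (Spec_ring_ideal P)|exact: Spec_not1|].
    by rewrite tofrac0 mul0r.
  - exists (a * t + b * s), (s * t); split; last 1 first.
    + by rewrite addf_div ?(Spec_compl_neq0 Ps) ?(Spec_compl_neq0 Pt) // tofracD !tofracM.
    + by apply: SpecD; [rewrite mulrC|rewrite mulrC]; exact: SpecMl.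
    + exact: Spec_complM.
  - have [a [s [Ps ijE]]] := Inv_mul_opp Ii Jj.
    exists a, s; split=> //; apply: contrapT => Pa; apply: nu.
    exists i, j; split=> //; rewrite ijE; split.
      by rewrite mulf_neq0 ?invr_eq0 ?(Spec_compl_neq0 Ps) ?(Spec_compl_neq0 Pa).
    by rewrite invf_div; exists s, a.
have x0 : x != 0 by apply: contraNneq xy0 => ->; rewrite mul0r.
exists (MkInv (invertible_principal (domain D) x0)); apply: Inv_ext => /=.
apply/seteqP; split.
  have Ifr := proj1 (InvP I).
  apply: ideal_mul_ind; [exact: fideal0 Ifr|apply: (fidealD Ifr)|].
  move=> _ b [a Da ->] Lb; rewrite -mulrA mulrC; apply: (fidealM Ifr) => //.
  by apply: subdomainM => //; exact: domain_sub_localization Da.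
move=> z Iz; have -> : z = x * ((x * y)^-1 * (y * z)).
  by rewrite mulrCA (mulrA x) mulKf.
apply: ideal_mul_gen; first by exists 1; [exact: subdomain1|rewrite mulr1].
by apply: (@subdomainM _ L) => //; rewrite mulrC; exact: Inv_mul_opp Iz Iy.
Qed.

End Localization.

(** * The rank of a scattered space *)

Section WellOrder.
Variables (T : Type) (R : rel T).
Hypothesis Rwo : wochoice.well_order R.

(** The order axioms of [R] are recovered below by taking for [Q] sets of at most three points;
    antisymmetry comes from uniqueness. *)
Lemma well_order_min (Q : set T) : Q !=set0 -> exists2 z, Q z &
  (forall x, Q x -> R z x) /\
  forall y, Q y -> (forall x, Q x -> R y x) -> y = z.
Proof.
move=> [x Qx]; have [|z [[zQ zmin] zuniq]] := Rwo (A := mem Q).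
  by exists x; exact: mem_set.
exists z; first exact: set_mem; split=> [y Qy|y Qy ymin].
  exact/zmin/mem_set.
by apply/esym/zuniq; split=> [|u /set_mem]; [exact: mem_set|exact: ymin].
Qed.

Lemma well_order_refl x : R x x.
Proof.
have [|z -> [zmin _]] := @well_order_min [set x]; first by exists x.
exact: zmin.
Qed.

Lemma well_order_anti x y : R x y -> R y x -> x = y.
Proof.
move=> Rxy Ryx; have [|z _ [_ zuniq]] := @well_order_min [set x; y].
  by exists x; left.
have Rxx := well_order_refl.
rewrite (zuniq x); [|by left|by move=> u /= [] ->].
by rewrite (zuniq y) //; [right|move=> u /= [] ->].
Qed.

Lemma ord_lt_trans x y z : ord_lt R x y -> ord_lt R y z -> ord_lt R x z.
Proof.
move=> [Rxy xy] [Ryz yz].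
have [|m Qm [mmin _]] := @well_order_min [set x; y; z]; first by exists z; right.
have [mx my mz] : [/\ R m x, R m y & R m z].
  by split; apply: mmin; rewrite /=; tauto.
case: Qm => [[]|] /= mE; subst m.
- by split=> // xz; apply: xy; apply: well_order_anti => //; rewrite xz.
- by case: xy; exact: well_order_anti.
- by case: yz; exact: well_order_anti.
Qed.

Lemma ord_lt_wf : well_founded (ord_lt R).
Proof.
move=> x; apply: contrapT => nx.
have [|m nm [mmin _]] := @well_order_min [set t | ~ Acc (ord_lt R) t].
  by exists x.
apply: nm; constructor => y [Rym ym]; apply: contrapT => /mmin Rmy.
by apply: ym; exact: well_order_anti.
Qed.

End WellOrder.

(** The rank of [x] in [Y] is the first index whose set omits [x]. It is neither zero nor a limit,
    hence the successor of some [s]; so [x] is isolated in [S s], and nearby points of [Y] have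
    already left by stage [s]. *)
Lemma scattered_rank (X : topologicalType) (Y : set X) : scattered Y ->
  exists (T : Type) (R : T -> T -> Prop) (rho : X -> T),
    [/\ well_founded R, forall x y z, R x y -> R y z -> R x z &
      forall x, Y x -> exists2 V, nbhs x V &
        forall y, Y y -> V y -> y <> x -> R (rho y) (rho x)].
Proof.
move=> [T [R [S [Rwo [S0 Ssucc Slim] [t St0]]]]].
have first_out x : {t | ~ S t x & forall s, ~ S s x -> R t s}.
  apply: cid2; have [|m mQ [mmin _]] := well_order_min Rwo (Q := [set t | ~ S t x]).
    by exists t; rewrite /= St0.
  by exists m.
pose rho x := s2val (first_out x).
have rho_out x : ~ S (rho x) x by rewrite /rho; case: (first_out x).
have rho_min x s : ~ S s x -> R (rho x) s.
  by rewrite /rho; case: (first_out x) => m /= _; exact.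
exists T, (ord_lt R), rho; split; [exact: ord_lt_wf|exact: ord_lt_trans|].
move=> x Yx; have rho_lt s : ord_lt R s (rho x) -> S s x.
  move=> [Rs sx]; apply: contrapT => /rho_min Rx.
  by apply: sx; exact: well_order_anti Rwo _ _ Rs Rx.
have nzero : ~ ord_zero R (rho x) by move=> /S0 E; apply: (rho_out x); rewrite E.
have [s s_succ] : exists s, ord_succ R s (rho x).
  apply: contrapT => nsucc; apply: (rho_out x).
  rewrite Slim => [s /= /rho_lt //|]; split=> // s ss.
  by apply: nsucc; exists s.
have [s_lt _] := s_succ; have Sx := rho_lt s s_lt.
have : isolated (S s) x.
  by apply: contrapT => nisol; apply: (rho_out x); rewrite (Ssucc s).
move=> [_ [V Vx VS]]; exists V => // y Yy Vy yx.
have nSy : ~ S s y.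
  by move=> Sy; apply: yx; have : (V `&` S s) y by []; rewrite VS.
have Rys := rho_min _ _ nSy.
have [->//|ys] := pselect (rho y = s).
by apply: (ord_lt_trans Rwo _ s_lt).
Qed.

(** * Supports in the inverse topology *)

Section Splitting.
Variable D : idomainType.
Implicit Types (P M N : Spec D) (C : set (Spec D)) (I J : InvGroup (domain D)).

Local Notation "x %:F" := (@FracField.tofrac D x).

(* On the closed set of the primes containing [x], [C] is cut out by an
   idempotent of [D / (x)]. *)
Definition splits C := forall x : D, x != 0 -> exists e r : D,
  e * (1 - e) = x * r /\
  forall P, Spec_set P x -> (C P <-> ~ Spec_set P e).

Lemma splitsT : splits setT.
Proof.
move=> x x0; exists 1, 0; split; first by rewrite subrr !mulr0.
by move=> P _; split=> // _; exact: Spec_not1.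
Qed.

Lemma splitsI C C' : splits C -> splits C' -> splits (C `&` C').
Proof.
move=> sC sC' x x0; have [e [r [er eC]]] := sC x x0.
have [f [t [ft fC']]] := sC' x x0; exists (e * f), (f * r + e ^+ 2 * t); split.
  have -> : e * f * (1 - e * f) = f * (e * (1 - e)) + e ^+ 2 * (f * (1 - f)).
    by ring.
  by rewrite er ft; ring.
move=> P Px; split=> [[/(eC P Px) Pe /(fC' P Px) Pf]|nP].
  exact: Spec_complM.
split; [apply/(eC P Px)|apply/(fC' P Px)] => Pu; apply: nP; last exact: SpecMl.
by rewrite mulrC; exact: SpecMl.
Qed.

Lemma splits_bigI (I : eqType) (s : seq I) (F : I -> set (Spec D)) :
  (forall i, i \in s -> splits (F i)) -> splits (\big[setI/setT]_(i <- s) F i).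
Proof.
by move=> sF; rewrite big_seq; apply: big_ind => //; [exact: splitsT|exact: splitsI].
Qed.

(** Containing [L] means containing its finitely many generators, and [dim1_idempotent] treats a
    single one. *)
Lemma splits_fg (dimD : krull_dim_eq D 1) (L : set D) :
  fg_ideal L -> splits [set P : Spec D | L `<=` P].
Proof.
move=> [s _ <-].
rewrite (_ : mkset _ =
  \bigcap_(y in [set` s]) [set P : Spec D | Spec_set P y]); last first.
  apply/seteqP; split=> P /= sP.
    move=> y /= ys; apply: sP; rewrite -(nth_index 0 ys).
    have yi : (index y s < size s)%N by rewrite index_mem.
    exists (fun i => (i == index y s)%:R).
    rewrite (bigD1 (Ordinal yi)) //= eqxx mul1r big1 ?addr0 // => i.
    by rewrite -val_eqE /= => /negbTE ->; rewrite mul0r.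
  move=> _ [c ->]; apply: big_ind => [|u v|i _].
  - by case: (Spec_ring_ideal P).
  - exact: SpecD.
  - by apply/SpecMl/sP; rewrite /= mem_nth.
rewrite bigcap_seq; apply: splits_bigI => y _ x x0; exact: dim1_idempotent.
Qed.

Lemma nbhs_splits (dimD : krull_dim_eq D 1) P (V : set (Spec D)) :
  nbhs P V -> exists C, [/\ splits C, C P & C `<=` V].
Proof.
rewrite nbhsE => -[B [oB BP] BV].
case: oB BP BV => F Fsub <- [C FC CP] CV.
have [E EF EC] := Fsub C FC.
exists C; split=> // [|Q CQ]; last by apply: CV; exists C.
rewrite -EC bigcap_fset; apply: splits_bigI => L LE.
by apply: splits_fg => //; exact/set_mem/EF.
Qed.

Lemma Inv_restrict C I : splits C -> exists J, forall P,
  (C P -> Inv_localize P J = Inv_localize P I) /\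
  (~ C P -> Inv_localize P J = 0).
Proof.
move=> sC; have [_ [[x _ <-] x0 xI xI']] := Inv_denom I.
rewrite tofrac_eq0 in x0; have [e [r [er eC]]] := sC x x0.
have [De Dx Dr] : [/\ domain_set e%:F, domain_set x%:F & domain_set r%:F].
  by split; [exists e|exists x|exists r].
have x0F : x%:F != 0 by rewrite tofrac_eq0.
have erF : e%:F * (1 - e%:F) = x%:F * r%:F.
  by rewrite -tofrac1 -tofracB -!tofracM er.
have Ifr := proj1 (InvP I); have I'fr := proj1 (InvP (- I)).
have Jinv : invertible (domain D) (restriction (domain D) e%:F I).
  have fr := @fractional_restriction _ (domain D) _ _ De Dx x0F.
  split; first exact: fr Ifr xI.
  exists (restriction (domain D) e%:F (- I : InvGroup _)); first exact: fr I'fr xI'.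
  exact: (@restriction_mul _ (domain D) _ _ _ De Dx x0F Dr erF _ _
    Ifr I'fr xI xI' (Inv_oppK I)).
pose J := MkInv Jinv.
have Jfr := proj1 (InvP J).
(* Where [e] is a unit, multiplying by it carries [J] into [I], because [e * (1 - e)] is a multiple
   of [x] and [x] lies in [I]. *)
have JI P : ~ Spec_set P e -> Inv_localize P J = Inv_localize P I.
  move=> Pe; apply: Inv_ext; apply/seteqP; split;
    apply: extension_localization_le => //.
    move=> _ [i Ii [a Da ->]]; exists e => //.
    have -> : e%:F * (e%:F * i + (1 - e%:F) * a) =
        (e%:F * e%:F) * i + (r%:F * a) * x%:F.
      by rewrite mulrDr [e%:F * (_ * a)]mulrA erF; ring.
    have Ix : Inv_set I x%:F by exact: mem_ideal_of_inverse Ifr (Inv_oppK I) xI'.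
    by apply: (fidealD Ifr); apply: (fidealM Ifr) => //;
      apply: (@subdomainM _ (domain D)).
  move=> i Ii; exists e => //; exists i => //; exists 0; first exact: (subdomain0 (domain D)).
  by rewrite mulr0 addr0.
have J0 P : Spec_set P e -> Inv_localize P J = 0.
  move=> Pe.
  have P1e : ~ Spec_set P (1 - e).
    by move=> P1e; apply: (@Spec_not1 _ P); rewrite -[1](subrK e); exact: SpecD.
  have F1e : (1 - e)%:F = 1 - e%:F by rewrite tofracB tofrac1.
  have D1e : domain_set (1 - e%:F) by exists (1 - e).
  apply: Inv_ext; rewrite -(raddf0 (Inv_localize P)).
  apply/seteqP; split; apply: extension_localization_le => //;
    try exact: fractional_subdomain.
    move=> _ [i Ii [a Da ->]]; exists (1 - e) => //; rewrite F1e.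
    have -> : (1 - e%:F) * (e%:F * i + (1 - e%:F) * a) =
        (e%:F * (1 - e%:F)) * i + (1 - e%:F) * (1 - e%:F) * a by ring.
    rewrite erF (mulrC x%:F) -[r%:F * _ * i]mulrA; have Dxi := xI i Ii.
    by apply: (@subdomainD _ (domain D));
      do ?[assumption|apply: (@subdomainM _ (domain D))].
  move=> z Dz; exists (1 - e) => //; rewrite F1e.
  by exists 0; [exact: fideal0 Ifr|exists z => //; rewrite mulr0 add0r].
have I0 P : ~ Spec_set P x -> Inv_localize P I = 0.
  by move=> Px; exact: localize_eq0 Px xI xI'.
(* At primes containing [x], [e] decides. At the others [I] is trivial, and so is [J] whether or not
   [e] is in [P]. *)
exists J => P; have [Px|Px] := pselect (Spec_set P x).
  split=> [/(eC P Px)|nC]; first exact: JI.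
  by apply: J0; apply: contrapT => /(eC P Px).
have [Pe|Pe] := pselect (Spec_set P e); first by rewrite I0 // J0.
by rewrite JI // I0.
Qed.

(** The [y] for which the part of the support where [y] is a unit has a finite cover form an ideal
    [B]. It is the unit ideal, since each maximal ideal misses an element of [B]. *)
Lemma localization_support_compact I (U : Spec D -> set (Spec D)) :
  (forall M, MaxSpec M -> splits (U M) /\ U M M) ->
  exists2 s : seq (Spec D),
    forall M, M \in s -> MaxSpec M /\ Inv_localize M I <> 0 &
    forall N, MaxSpec N -> Inv_localize N I <> 0 -> exists2 M, M \in s & U M N.
Proof.
move=> UP.
pose B := [set y : D | exists2 s : seq (Spec D),
  forall M, M \in s -> MaxSpec M /\ Inv_localize M I <> 0 &
  forall N, MaxSpec N -> Inv_localize N I <> 0 -> ~ Spec_set N y ->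
    exists2 M, M \in s & U M N].
have Bi : ring_ideal B.
  split; first by exists [::] => // N _ _ []; case: (Spec_ring_ideal N).
  move=> a u v [s sI su] [t tI tv]; exists (s ++ t).
    by move=> M; rewrite mem_cat => /orP[/sI|/tI].
  move=> N Nmax NI Nuv; have [Nu|Nu] := pselect (Spec_set N u).
    have [|M Mt UMN] := tv N Nmax NI.
      by move=> Nv; apply: Nuv; apply: SpecD => //; exact: SpecMl.
    by exists M => //; rewrite mem_cat Mt orbT.
  by have [M Ms UMN] := su N Nmax NI Nu; exists M => //; rewrite mem_cat Ms.
have [[s sI sU]|/(exists_maximal Bi)[M Mmax BM]] := pselect (B 1).
  by exists s => // N Nmax NI; apply: sU => //; exact: Spec_not1.
exfalso.
have [MI|MI] := pselect (Inv_localize M I = 0).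
  have [y My yI] := localize_eq0_nbhd MI; apply/My/BM.
  by exists [::] => // N _ NI /yI.
have [_ [[x _ <-] x0 xI xI']] := Inv_denom I; rewrite tofrac_eq0 in x0.
have suppx N : ~ Spec_set N x -> Inv_localize N I = 0.
  by move=> Nx; exact: localize_eq0 Nx xI xI'.
(* [x] is in [B] with the empty list, so [M] contains [x] and therefore not the [e] attached to
   [U M]; yet [e] is in [B] with the list [[:: M]]. *)
have Mx : Spec_set M x by apply: BM; exists [::] => // N _ NI /suppx.
have [sU UMM] := UP M Mmax; have [e [r [er eU]]] := sU x x0.
have Me := (eU M Mx).1 UMM; apply/Me/BM.
exists [:: M]; first by move=> N; rewrite inE => /eqP ->.
move=> N Nmax NI Ne; exists M; first exact: mem_head.
by apply/eU => //; apply: contrapT => /suppx.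
Qed.

End Splitting.

Theorem corollary5p3 (D : idomainType)
  (dimD : krull_dim_eq D 1)
  (scatteredD : scattered (@MaxSpec D))
  (freeDM : forall M : Spec D,
     MaxSpec M -> free_abelian (InvGroup (localization M))) :
  isomorphic (InvGroup (domain D))
    (dirsum (fun M : @MaxSpec D => InvGroup (localization (\val M)) : zmodType)) /\
  free_abelian (InvGroup (domain D)).
Proof.
pose G (M : @MaxSpec D) : zmodType := InvGroup (localization (\val M)).
have maxP (M : @MaxSpec D) : MaxSpec (\val M) by exact: set_valP.
suff iso : isomorphic (InvGroup (domain D)) (dirsum G).
  split=> //; have [B Biso] : free_abelian (dirsum G).
    by apply: free_abelian_dirsum => M; exact/freeDM/maxP.
  by exists B; exact: isomorphic_trans iso Biso.
have [T [R [rho [Rwf Rtrans rhoP]]]] := scattered_rank scatteredD.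
(* The neighbourhood where ranks drop is shrunk to one that splits, so that ideals can be restricted
   to it; [setT] is a filler at the non-maximal primes. *)
have /all_sig[U UP] (M : Spec D) : {U | MaxSpec M -> [/\ splits U, U M &
    forall N, MaxSpec N -> U N -> N <> M -> R (rho N) (rho M)]}.
  apply: cid; have [Mmax|] := pselect (MaxSpec M); last by exists setT.
  have [V /(nbhs_splits dimD)[C [sC CM CV]] VP] := rhoP M Mmax.
  by exists C => _; split=> // N Nmax /CV; exact: VP.
apply: (@ranked_decomposition _ G _ (fun M => Inv_localize (\val M)) T R
  (fun M => rho (\val M)) (fun M => [set N | U (\val M) (\val N)])) => //.
- by move=> M; have [] := UP _ (maxP M).
- move=> M N UMN NM; have [_ _ UM] := UP _ (maxP M).
  by apply: UM => [||/val_inj] //; exact: maxP.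
- move=> I I0; apply: localize_inj => M Mmax.
  exact: (I0 (SigSub (mem_set Mmax))).
- move=> M I; have [sU _ _] := UP _ (maxP M).
  have [J JP] := Inv_restrict I sU; exists J.
  by split=> N; [exact: (JP (\val N)).2|exact: (JP (\val N)).1].
- by move=> M; exact: localize_surj.
- move=> I; have [|s sI sU] := @localization_support_compact _ I U.
    by move=> M /UP[].
  (* The listed primes are maximal, so the list lifts to the index type of the direct sum. *)
  have [r rs] : exists r : seq (@MaxSpec D), map \val r = s.
    elim: (s) sI => [|M t IHt] tI; first by exists [::].
    have [|r rt] := IHt; first by move=> N Nt; apply: tI; rewrite inE Nt orbT.
    have [Mmax _] := tI M (mem_head _ _).
    by exists (SigSub (mem_set Mmax) :: r); rewrite /= rt.
  exists r => [M Mr|N nN].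
    by apply: (sI _ _).2; rewrite -rs map_f.
  apply: contrapT => NI; apply: nN.
  have [M] := sU _ (maxP N) NI; rewrite -rs => /mapP[M' M'r ->] UM.
  by exists M'.
- by move=> M; exact/freeDM/maxP.
Qed.
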